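(* Let $F$ be a nonempty closed subset of $H$, let $\phi\colon[0,+\infty)\to[0,+\infty)$ be a strictly increasing function such that $\lim_{t\to+\infty}\phi(t)=+\infty$, and let $(x_n)_{n\in\mathbb N}$ be a sequence of $H$-valued random variables. Suppose that, for every $z\in F$, there exist $(\chi_n(z))_{n\in\mathbb N}\in\ell_+^1(\mathscr X)$, $(\vartheta_n(z))_{n\in\mathbb N}\in\ell_+(\mathscr X)$, and $(\eta_n(z))_{n\in\mathbb N}\in\ell_+^1(\mathscr X)$ such that the following is satisfied $\mathsf P$-a.s.: $$(\forall n\in\mathbb N)\quad \mathsf E\big(\phi(\|x_{n+1}-z\|)\,\big|\,\mathcal X_n\big)+\vartheta_n(z)\le(1+\chi_n(z))\,\phi(\|x_n-z\|)+\eta_n(z).$$ Then the following hold: (i) For every $z\in F$, $\sum_{n\in\mathbb N}\vartheta_n(z)<+\infty$ $\mathsf P$-a.s. (ii) $(x_n)_{n\in\mathbb N}$ is bounded $\mathsf P$-a.s. (iii) There exists $\widetilde\Omega\in\mathcal F$ such that $\mathsf P(\widetilde\Omega)=1$ and, for every $\omega\in\widetilde\Omega$ and every $z\in F$, $(\|x_n(\omega)-z\|)_{n\in\mathbb N}$ converges. (iv) Suppose that $\mathfrak W(x_n)_{n\in\mathbb N}\subset F$ $\mathsf P$-a.s. Then $(x_n)_{n\in\mathbb N}$ converges weakly $\mathsf P$-a.s. to an $F$-valued random variable. (v) Suppose that $\mathfrak S(x_n)_{n\in\mathbb N}\cap F\neq\varnothing$ $\mathsf P$-a.s. Then $(x_n)_{n\in\mathbb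 N}$ converges strongly $\mathsf P$-a.s. to an $F$-valued random variable. (vi) Suppose that $\mathfrak S(x_n)_{n\in\mathbb N}\neq\varnothing$ $\mathsf P$-a.s. and that $\mathfrak W(x_n)_{n\in\mathbb N}\subset F$ $\mathsf P$-a.s. Then $(x_n)_{n\in\mathbb N}$ converges strongly $\mathsf P$-a.s. to an $F$-valued random variable.
   Context: $H$ is a separable real Hilbert space with norm $\|\cdot\|$ and Borel $\sigma$-algebra $\mathcal B$; $(\Omega,\mathcal F,\mathsf P)$ is the underlying probability space. An $H$-valued random variable is a measurable map $(\Omega,\mathcal F)\to(H,\mathcal B)$. For a sequence $(y_n)_{n\in\mathbb N}$ in $H$, $\mathfrak S(y_n)_{n\in\mathbb N}$ and $\mathfrak W(y_n)_{n\in\mathbb N}$ denote its sets of strong and weak sequential cluster points, respectively; for random sequences these are taken pointwise in $\omega$. Given a sequence $(x_n)_{n\in\mathbb N}$ of $H$-valued random variables, $\mathscr X=(\mathcal X_n)_{n\in\mathbb N}$ with $\mathcal X_n=\sigma(x_0,\dots,x_n)$. $\ell_+(\mathscr X)$ is the set of sequences $(\xi_n)_{n\in\mathbb N}$ of $[0,+\infty)$-valued random variables such that $\xi_n$ is $\mathcal X_n$-measurable for every $n$; and $\ell_+^1(\mathscr X)=\{(\xi_n)_{n\in\mathbb N}\in\ell_+(\mathscr X) : \sum_{n\in\mathbb N}\xi_n<+\infty\ \mathsf P\text{-a.s.}\}$. Equalities and inequalities involving random variables are understood to hold $\mathsf P$-almost surely. *)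

(* Defs.v *)
From mathcomp Require Import all_boot all_order all_algebra.
From mathcomp Require Import all_classical all_reals all_analysis.
From mathcomp Require Import measurable_realfun.

Set Implicit Arguments.
Unset Strict Implicit.
Unset Printing Implicit Defensive.

Import Order.TTheory GRing.Theory Num.Theory.
Import numFieldNormedType.Exports.

Local Open Scope classical_set_scope.
Local Open Scope ring_scope.

Definition separable (U : topologicalType) : Prop :=
  exists2 D : set U, countable D & dense D.

(* A real Hilbert space is a complete normed module whose norm is induced by
   an inner product. [{dot H for idfun}] is the type of symmetric positive
   definite bilinear forms on H. *)
Definition induces_norm (R : realType) (H : normedModType R)
    (ip : {dot H for (@idfun R)}) : Prop :=
  forall u : H, ip u u = `|u| ^+ 2.

Definition weak_cvg (R : realType) (H : normedModType R)
    (ip : {dot H for (@idfun R)}) (y : nat -> H) (l : H) : Prop :=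
  forall u : H, ip (y n) u @[n --> \oo] --> ip l u.

Definition strong_cluster (R : realType) (H : normedModType R)
    (y : nat -> H) : set H :=
  [set l | exists2 k : nat -> nat, increasing_seq k & y (k n) @[n --> \oo] --> l].

Definition weak_cluster (R : realType) (H : normedModType R)
    (ip : {dot H for (@idfun R)}) (y : nat -> H) : set H :=
  [set l | exists2 k : nat -> nat, increasing_seq k & weak_cvg ip (y \o k) l].

Definition borel (R : realType) (H : normedModType R) :=
  g_sigma_algebraType (@open H).

Definition random_vector d (Omega : measurableType d) (R : realType)
    (H : normedModType R) (X : Omega -> H) : Prop :=
  measurable_fun [set: Omega] (X : Omega -> borel H).

Definition measurable_wrt d (Omega : measurableType d)
    (G : set (set Omega)) d' (U : measurableType d') (f : Omega -> U) : Prop :=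
  measurable_fun [set: g_sigma_algebraType G] (f : g_sigma_algebraType G -> U).

Definition natural_filtration d (Omega : measurableType d) (R : realType)
    (H : normedModType R) (x : nat -> Omega -> H) (n : nat) :
    set (set Omega) :=
  g_sigma_preimage (fun i : 'I_n.+1 => (x i : Omega -> borel H)).

Definition ell_plus d (Omega : measurableType d) (R : realType)
    (X : nat -> set (set Omega)) : set (nat -> Omega -> R) :=
  [set xi : nat -> Omega -> R | forall n, (forall w, 0 <= xi n w) /\
    measurable_wrt (X n) (xi n)].

Definition ell1_plus d (Omega : measurableType d) (R : realType)
    (P : probability Omega R) (X : nat -> set (set Omega)) :
    set (nat -> Omega -> R) :=
  [set xi : nat -> Omega -> R | ell_plus X xi /\
    {ae P, forall w, (\sum_(0 <= n <oo) (xi n w)%:E < +oo)%E}].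

(* [Y] is a version of E(f | G) for a sub-sigma-algebra G and a nonnegative
   measurable f. As f need not be integrable, both sides of the averaging
   identity, and the values of Y, may be +oo. *)
Definition is_cond_exp d (Omega : measurableType d) (R : realType)
    (P : probability Omega R) (G : set (set Omega))
    (f Y : Omega -> \bar R) : Prop :=
  [/\ measurable_wrt G Y,
      (forall w, (0 <= Y w)%E) &
      forall A, G A -> (\int[P]_(w in A) Y w = \int[P]_(w in A) f w)%E].

(* Main.v *)
Require Import Defs.
From mathcomp Require Import all_boot all_order all_algebra.
From mathcomp Require Import all_classical all_reals all_analysis.
From mathcomp Require Import measurable_realfun.
From mathcomp Require Import ring lra.

Set Implicit Arguments.
Unset Strict Implicit.
Unset Printing Implicit Defensive.

Import Order.TTheory GRing.Theory Num.Theory.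
Import numFieldNormedType.Exports.

Local Open Scope classical_set_scope.
Local Open Scope ring_scope.

(** For a fixed [z] in [F], the process [phi `|x n - z|] is a nonnegative almost
    supermartingale, so the Robbins-Siegmund theorem
    ([almost_supermartingale_cvg]) gives that it converges almost surely and
    that [theta z] is almost surely summable. As [phi] is strictly increasing
    and tends to infinity, [`|x n - z|] converges as well
    ([cvgn_of_increasing]). The exceptional null set depends on [z]; since [F]
    is separable, a countable dense subset of [F] yields a single null set
    outside of which [`|x n w - z|] converges for all [z] in [F]
    ([Fejer_path_dense]). From there on everything takes place along one
    trajectory [y n = x n w].

    Such a trajectory is bounded, hence has weak cluster points: the limits of
    [<y n, u>] along an ultrafilter form a bounded linear functional of [u],
    which the Riesz theorem represents by a vector, and separability turns this
    limit into the limit of a subsequence ([ultra_weak_cluster]). Opial's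
    argument shows that there is at most one weak cluster point in [F]
    ([Fejer_path_weak_cluster_unique]); if all of them are in [F], then the
    whole trajectory converges weakly. If a strong cluster point [l] is in [F],
    then the limit of [`|y n - l|] is its limit along a subsequence, namely [0].
    A limit in the weak sense is a random vector because in a separable Hilbert
    space the Borel sets are generated by half-spaces
    ([weakly_measurable_random_vector]).

    The Robbins-Siegmund theorem itself follows by discounting the process by
    the product of the factors [1 + chi k], adding the accumulated [theta] and
    removing the accumulated [eta]; killed when the latter exceeds a level [m],
    this is a nonnegative supermartingale. No integrability is available:
    neither [phi `|x 0 - z|] nor the conditional expectations need have a finite
    integral. The convergence theorem for nonnegative supermartingales is
    therefore proved with integrals valued in [0, +oo], by Dubins' argument:
    each upcrossing of [a, b] multiplies the probability by at most [a / b],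
    whatever the initial value, so that infinitely many upcrossings have
    probability zero ([oscillation_bound]). *)

(** * Inner products *)

Section inner_product.
Context {R : realType} {H : normedModType R} (ip : {dot H for (@idfun R)}).

Lemma ip_sym u v : ip u v = ip v u.
Proof. by rewrite (@hermC _ false idfun) /= expr0 mul1r. Qed.

Lemma ipZl (a : R) u v : ip (a *: u) v = a * ip u v.
Proof. by rewrite linearZl_LR. Qed.

Lemma ipZr (a : R) u v : ip u (a *: v) = a * ip u v.
Proof. by rewrite ip_sym ipZl ip_sym. Qed.

Hypothesis ipN : induces_norm ip.

Lemma sqr_normD u v : `|u + v| ^+ 2 = `|u| ^+ 2 + 2 * ip u v + `|v| ^+ 2.
Proof. by rewrite -!ipN linearDl !linearDr /= (ip_sym v u); ring. Qed.

Lemma sqr_normB u v : `|u - v| ^+ 2 = `|u| ^+ 2 - 2 * ip u v + `|v| ^+ 2.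
Proof. by rewrite -!ipN linearBl !linearBr /= (ip_sym v u); ring. Qed.

Lemma Cauchy_Schwarz u v : `|ip u v| <= `|u| * `|v|.
Proof.
have [->|v0] := eqVneq v 0; first by rewrite linear0r !normr0 mulr0.
rewrite -(@ler_pXn2r _ 2)// ?nnegrE ?mulr_ge0// -normrX exprMn.
rewrite ger0_norm ?sqr_ge0//.
have a0 : 0 < `|v| ^+ 2 by rewrite exprn_gt0// normr_gt0.
rewrite -(ler_pM2l a0) -subr_ge0.
have := ipN (`|v| ^+ 2 *: u - ip u v *: v).
rewrite linearBl !linearBr /= !ipZl !ipZr !ipN (ip_sym v u) => h.
suff -> : `|v| ^+ 2 * (`|u| ^+ 2 * `|v| ^+ 2) - `|v| ^+ 2 * ip u v ^+ 2 =
  `| `|v| ^+ 2 *: u - ip u v *: v| ^+ 2 by exact: sqr_ge0.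
by rewrite -h; ring.
Qed.

Lemma ip_continuousl u : continuous (ip^~ u).
Proof.
move=> v; apply/cvgrPdist_le => e e0; near=> t.
rewrite -linearBl; apply: le_trans (Cauchy_Schwarz _ _) _.
have : `|v - t| <= e / (`|u| + 1).
  near: t; apply: cvgr_dist_le; [exact: cvg_id|].
  by rewrite divr_gt0// ltr_wpDl.
rewrite ler_pdivlMr ?ltr_wpDl// => h; apply: le_trans h.
by rewrite ler_wpM2l// lerDl.
Unshelve. all: by end_near. Qed.

End inner_product.

(** * Separable sets *)

Section dense_sequences.
Context {R : realType} {H : normedModType R}.

Lemma separable_dense_seq : separable H ->
  exists e : nat -> H, forall v eps, 0 < eps -> exists i, `|v - e i| < eps.
Proof.
move=> [D cD dD].
have ball_meets v eps : 0 < eps -> exists2 x, D x & `|v - x| < eps.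
  move=> e0; have vb : ball v eps !=set0 by exists v; exact: ballxx.
  have [x [vx Dx]] := dD _ vb (ball_open v eps).
  by exists x => //; move: vx; rewrite -ball_normE.
have [D0|[f]] := pfcard_geP cD.
  by have [x] := ball_meets 0 1 ltr01; rewrite D0.
exists f => v eps /(ball_meets v)[x Dx vx].
by have [i _ fi] := @surj _ _ _ _ f _ Dx; exists i; rewrite fi.
Qed.

(** Subsets of a separable metric space are separable: keep one point of [F]
    in each ball of radius [1 / k.+1] around the dense sequence that meets
    [F]. *)
Lemma separable_subset (F : set H) : separable H -> F !=set0 ->
  exists2 f : nat -> H, (forall i, F (f i)) &
    forall z eps, F z -> 0 < eps -> exists i, `|z - f i| < eps.
Proof.
move=> /separable_dense_seq[e eP] [z0 Fz0].
have pick (ik : nat * nat) : exists z, F z /\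
    ((exists2 z', F z' & `|z' - e ik.1| < ik.2.+1%:R^-1) ->
    `|z - e ik.1| < ik.2.+1%:R^-1).
  have [[z' Fz' z'P]|no] := pselect (exists2 z', F z' &
      `|z' - e ik.1| < ik.2.+1%:R^-1); first by exists z'.
  by exists z0.
have [g gP] := choice pick.
exists (fun n => g (odflt (0, 0)%N (unpickle n))) => [i|z eps Fz eps0].
  by have [] := gP (odflt (0, 0)%N (unpickle i)).
have [k keps] : exists k, k.+1%:R^-1 < eps / 2.
  have [k _ kP] := near_infty_natSinv_lt (PosNum (divr_gt0 eps0 (ltr0n R 2))).
  by exists k; exact: kP (leqnn k).
have [i zi] := eP z k.+1%:R^-1 (ltac:(by rewrite invr_gt0)).
exists (pickle (i, k)); rewrite pickleK/=.
have [_ /(_ _)gi] := gP (i, k).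
have {}gi := gi (ex_intro2 _ _ z Fz zi); rewrite /= in gi.
rewrite -(subrKA (e i)) (splitr eps).
rewrite (le_lt_trans (ler_normD _ _))// ltrD// ?(lt_trans zi)//.
by rewrite distrC (lt_trans gi).
Qed.

End dense_sequences.

(** * Riesz representation and weak compactness *)

Section Riesz.
Context {R : realType} {H : completeNormedModType R}
  (ip : {dot H for (@idfun R)}) (ipN : induces_norm ip).

(** The representative is the minimiser of [|v|^2 - 2 L v]. The parallelogram
    law makes every minimising sequence Cauchy, and comparing the values at
    [v] and at [v + t w] bounds [<v, w> - L w] by the defect of minimality
    of [v]. *)
Lemma Riesz_representation (L : H -> R) (M : R) :
  scalar L -> (forall u, `|L u| <= M * `|u|) ->
  exists l, forall u, L u = ip l u.
Proof.
move=> Llin LM.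
have LD u v : L (u + v) = L u + L v.
  by have := Llin 1 u v; rewrite scale1r mul1r.
have L0 : L 0 = 0.
  by apply: (addrI (L 0)); rewrite -LD !addr0.
have LZ a u : L (a *: u) = a * L u.
  by have := Llin a u 0; rewrite !addr0 L0 addr0.
pose J v := `|v| ^+ 2 - 2 * L v.
have Jlb : has_lbound (range J).
  exists (- M ^+ 2) => _ [v _ <-]; rewrite /J.
  have := le_trans (ler_norm _) (LM v).
  by have := sqr_ge0 (`|v| - M); rewrite sqrrB; lra.
have Jinf : has_inf (range J) by split=> //; exists (J 0); exists 0.
pose i := inf (range J).
have iJ v : i <= J v by apply: ge_inf => //; exists v.
have near_inf (n : nat) : exists v : H, J v < i + n.+1%:R^-1.
  have n0 : 0 < n.+1%:R^-1 :> R by rewrite invr_gt0.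
  by have [_ [v _ <-] h] := inf_adherent n0 Jinf; exists v.
have [v_ vP] := choice near_inf.
have Jmid u v : `|u - v| ^+ 2 = 2 * J u + 2 * J v - 4 * J (2^-1 *: (u + v)).
  rewrite /J LZ LD normrZ exprMn (sqr_normB ipN) (sqr_normD ipN).
  by rewrite ger0_norm//; field.
have vcvg : cvgn v_.
  apply/cauchy_cvgP/cauchy_exP => e e0.
  have e4 : 0 < e ^+ 2 / 4 by rewrite divr_gt0// exprn_gt0.
  have [N _ NP] := near_infty_natSinv_lt (PosNum e4).
  exists (v_ N); exists N => // n Nn; rewrite -ball_normE /ball_/=.
  rewrite -(@ltr_pXn2r _ 2)// ?nnegrE//; last exact: ltW.
  rewrite Jmid; have := iJ (2^-1 *: (v_ N + v_ n)).
  have vlt m : (N <= m)%N -> J (v_ m) < i + e ^+ 2 / 4.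
    by move=> Nm; rewrite (lt_trans (vP m))// ltrD2l; exact: NP.
  by have := vlt _ (leqnn N); have := vlt _ Nn; lra.
have [l vl] := (cvg_ex _).1 vcvg.
exists l => w.
have quad n : (ip (v_ n) w - L w) ^+ 2 <= `|w| ^+ 2 * n.+1%:R^-1.
  have [->|w0] := eqVneq w 0.
    by rewrite linear0r L0 subrr expr0n/= normr0 expr0n/= mul0r.
  set c := ip (v_ n) w - L w.
  have W0 : 0 < `|w| ^+ 2 by rewrite exprn_gt0// normr_gt0.
  pose t := - c / `|w| ^+ 2.
  have : J (v_ n + t *: w) - J (v_ n) = t ^+ 2 * `|w| ^+ 2 + 2 * t * c.
    rewrite /J LD LZ (sqr_normD ipN) normrZ exprMn (ipZr ip).
    by rewrite real_normK ?num_real// /c; ring.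
  have -> : t ^+ 2 * `|w| ^+ 2 + 2 * t * c = - (c ^+ 2 / `|w| ^+ 2).
    by rewrite /t; field; rewrite normr_eq0.
  have := iJ (v_ n + t *: w); have := vP n => h1 h2 h3.
  rewrite [leRHS]mulrC -ler_pdivrMr//.
  by move: h1 h2 h3; move: (_ / _) (_^-1) (J _) (J _) => p q x y; lra.
have lw : ip (v_ n) w - L w @[n --> \oo] --> ip l w - L w.
  apply: cvgB; last exact: cvg_cst.
  exact: (cvg_comp _ _ vl (@ip_continuousl _ _ _ ipN w l)).
have lw2 : (ip (v_ n) w - L w) ^+ 2 @[n --> \oo] --> (ip l w - L w) ^+ 2.
  exact: (cvg_comp _ _ lw (@exprn_continuous R 2 _)).
have w0 : `|w| ^+ 2 * n.+1%:R^-1 @[n --> \oo] --> `|w| ^+ 2 * 0.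
  by apply: cvgM; [exact: cvg_cst|exact: cvg_harmonic].
have : (ip l w - L w) ^+ 2 <= `|w| ^+ 2 * 0.
  by apply: (ler_cvg_to lw2 w0); apply: filterE => n; exact: quad.
rewrite mulr0 real_exprn_even_le0// ?num_real//=.
by rewrite subr_eq0 => /eqP.
Qed.

End Riesz.

Section weak_compactness.

Lemma increasing_extraction (P : nat -> nat -> Prop) :
  (forall j N, exists2 n, (N <= n)%N & P j n) ->
  exists2 k : nat -> nat, increasing_seq k & forall j, P j (k j).
Proof.
move=> PP.
have next (jN : nat * nat) : exists n, (jN.2 <= n)%N /\ P jN.1 n.
  by have [n] := PP jN.1 jN.2; exists n.
have [f fP] := choice next.
pose k := fix k j := if j is j'.+1 then f (j, (k j').+1) else f (0, 0)%N.
exists k; first by apply/increasing_seqP => n; have [] := fP (n.+1, (k n).+1).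
by case=> [|j]; [have [] := fP (0, 0)%N | have [] := fP (j.+1, (k j).+1)].
Qed.

(** A cluster point of an ultrafilter is a limit, so compactness of segments
    suffices. *)
Lemma ultra_cvg_bounded {R : realType} (U : set_system nat) (f : nat -> R)
    (M : R) : UltraFilter U -> (forall n, `|f n| <= M) ->
  exists l : R, f n @[n --> U] --> l.
Proof.
move=> UU fM.
have UI : fmap f U `[- M, M]%classic.
  rewrite /fmap/= (_ : _ @^-1` _ = setT); first exact: filterT.
  by apply/seteqP; split=> // n _; rewrite /= in_itv/= -ler_norml.
have [p [_ clp]] := @segment_compact R (- M) M (fmap f U) _ UI.
exists p => B Bp; have [//|UB] := in_ultra_setVsetC (f @^-1` B) UU.
by have [x []] := clp (~` B) B UB Bp.
Qed.

Context {R : realType} {H : completeNormedModType R}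
  (ip : {dot H for (@idfun R)}) (ipN : induces_norm ip).

(** The error made in replacing [u] by a nearby [e i] is at most
    [(M + |l|) |u - e i|], uniformly in [n]. *)
Lemma weak_cvg_dense (e : nat -> H) (y : nat -> H) (l : H) (M : R) :
  (forall v eps, 0 < eps -> exists i, `|v - e i| < eps) ->
  (forall n, `|y n| <= M) ->
  (forall i, ip (y n) (e i) @[n --> \oo] --> ip l (e i)) -> weak_cvg ip y l.
Proof.
move=> eP yM ye u; apply/cvgrPdist_lt => eps eps0.
have M0 : 0 <= M by exact: le_trans (yM 0).
pose K := M + `|l| + 1.
have K0 : 0 < K by rewrite ltr_wpDl// addr_ge0.
have [i ui] := eP u (eps / 2 / K) (ltac:(by rewrite !divr_gt0)).
near=> n.
have -> : ip l u - ip (y n) u =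
    (ip l (e i) - ip (y n) (e i)) + ip (l - y n) (u - e i).
  by rewrite linearBl !linearBr /=; ring.
rewrite (le_lt_trans (ler_normD _ _))// (splitr eps) ltr_leD//.
  by near: n; apply: cvgr_dist_lt => //; rewrite divr_gt0.
rewrite (le_trans (Cauchy_Schwarz ipN _ _))//.
have -> : eps / 2 = K * (eps / 2 / K) by field; exact: lt0r_neq0.
rewrite ler_pM// ?(ltW ui)// /K (le_trans (ler_normB _ _))//.
by rewrite -addrA addrC -addrA lerD// (le_trans (yM n))// lerDr.
Unshelve. all: by end_near. Qed.

(** Weak compactness of balls, along an ultrafilter: the limits of [<y n, u>]
    define a bounded functional, represented by some [l], and the sets of
    indices at which finitely many coordinates of [y] are close to those of
    [l] belong to [U], hence are infinite, which yields a subsequence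
    converging weakly to [l]. *)
Lemma ultra_weak_cluster (U : set_system nat) (y : nat -> H) (M : R) :
  separable H -> UltraFilter U -> \oo `<=` U -> (forall n, `|y n| <= M) ->
  exists2 l, weak_cluster ip y l &
    forall u, ip (y n) u @[n --> U] --> ip l u.
Proof.
move=> sepH UU ooU yM.
have [e eP] := separable_dense_seq sepH.
have ipM u n : `|ip (y n) u| <= M * `|u|.
  by rewrite (le_trans (Cauchy_Schwarz ipN _ _))// ler_wpM2r.
have [L LP] := choice (fun u => ultra_cvg_bounded UU (ipM u)).
have Llin : scalar L.
  move=> a u v.
  have hR : hausdorff_space R by exact: norm_hausdorff.
  apply: (cvg_unique hR (LP (a *: u + v))) => /=.
  under eq_fun do rewrite linearDr /= ipZr.
  apply: cvgD; last exact: LP.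
  by apply: cvgM; [exact: cvg_cst|exact: LP].
have LM u : `|L u| <= M * `|u|.
  by apply: (cvgr_to_le (cvg_norm (LP u))); apply: filterE => n; exact: ipM.
have [l lP] := Riesz_representation ipN Llin LM.
exists l; last by move=> u; rewrite -lP.
have [k kincr kP] : exists2 k : nat -> nat, increasing_seq k &
    forall j i, (i <= j)%N -> `|ip l (e i) - ip (y (k j)) (e i)| < j.+1%:R^-1.
  apply: (@increasing_extraction (fun j n => forall i, (i <= j)%N ->
    `|ip l (e i) - ip (y n) (e i)| < j.+1%:R^-1)) => j N.
  have Ufin m : U [set n | forall i, (i < m)%N ->
      `|ip l (e i) - ip (y n) (e i)| < j.+1%:R^-1].
    elim: m => [|m IH]; first by apply: filterE.
    have Um : U [set n | `|ip l (e m) - ip (y n) (e m)| < j.+1%:R^-1].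
      have := LP (e m); rewrite lP => /cvgr_dist_lt; apply.
      by rewrite invr_gt0.
    apply: filterS (filterI IH Um) => n [h1 h2] i; rewrite ltnS leq_eqVlt.
    by move=> /predU1P[->//|]; exact: h1.
  have UN : U [set n | (N <= n)%N] by apply: ooU; exists N.
  have [n [h1 h2]] := filter_ex (filterI UN (Ufin j.+1)).
  by exists n.
exists k => //; apply: (weak_cvg_dense eP (fun n => yM (k n))) => i.
apply/cvgrPdist_lt => eps eps0; near=> j.
rewrite (lt_trans (kP j i _))//; first by near: j; exists i.
by near: j; exact: near_infty_natSinv_lt (PosNum eps0).
Unshelve. all: by end_near. Qed.

End weak_compactness.

(** * Borel measurability from weak measurability *)

Section weak_measurability.
Context {R : realType} {H : normedModType R}
  (ip : {dot H for (@idfun R)}) (ipN : induces_norm ip) (sepH : separable H)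
  d (T : measurableType d).

(** Pettis' argument: every open set of a separable [H] is a countable union of
    closed balls, and a closed ball is a countable intersection of half-spaces
    since [|v|^2] is the supremum of [2 <v, u> - |u|^2 = |v|^2 - |v - u|^2] over
    [u] in a dense sequence. *)
Lemma weakly_measurable_random_vector (X : T -> H) :
  (forall u, measurable_fun setT (fun w => ip (X w) u)) -> random_vector X.
Proof.
move=> mX; have [e eP] := separable_dense_seq sepH.
have closed_ballE (v : H) r : 0 <= r -> `|v| <= r <->
    forall i, 2 * ip v (e i) - `|e i| ^+ 2 <= r ^+ 2.
  move=> r0; split=> [vr i|h].
    have := sqr_ge0 `|v - e i|; rewrite (sqr_normB ipN).
    have : `|v| ^+ 2 <= r ^+ 2 by rewrite lerXn2r// nnegrE.
    lra.
  rewrite leNgt; apply/negP => rv.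
  (* a dense vector closer to [v] than the root of the excess contradicts [h] *)
  have gap : 0 < `|v| ^+ 2 - r ^+ 2 by rewrite subr_gt0 ltrXn2r// nnegrE.
  have [i vi] := eP v (Num.sqrt (`|v| ^+ 2 - r ^+ 2))
    (ltac:(by rewrite sqrtr_gt0)).
  have : `|v - e i| ^+ 2 < `|v| ^+ 2 - r ^+ 2.
    by rewrite -[ltRHS]sqr_sqrtr ?ltW// ltrXn2r// nnegrE// ?sqrtr_ge0.
  by rewrite (sqr_normB ipN); have := h i; lra.
have mball c r : 0 <= r -> measurable [set w | `|X w - c| <= r].
  move=> r0.
  have -> : [set w | `|X w - c| <= r] = \bigcap_i
      [set w | 2 * (ip (X w) (e i) - ip c (e i)) - `|e i| ^+ 2 <= r ^+ 2].
    apply/seteqP; split=> [w /= /closed_ballE -/(_ r0) h i _|w /= h].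
      by have := h i; rewrite linearBl.
    by apply/closed_ballE => // i; have := h i I; rewrite /= linearBl.
  apply: bigcapT_measurable => i.
  rewrite -[X in measurable X]setTI.
  apply: measurable_fun_ler => //; apply: measurable_funB => //.
  apply: measurable_funM => //; apply: measurable_funB => //.
apply: (@measurability _ _ T (borel H) setT X (@open H)); first by [].
move=> _ [A oA <-].
rewrite setTI.
pose B (ik : nat * nat) := [set v : H | `|v - e ik.1| <= ik.2.+1%:R^-1].
pose I := [set ik : nat * nat | B ik `<=` A].
have -> : X @^-1` A =
    \bigcup_(ik in I) [set w | `|X w - e ik.1| <= ik.2.+1%:R^-1].
  apply/seteqP; split=> [w AX|w [ik Iik /Iik]//].
  have /nbhs_ballP[eps/= eps0 epsA] : nbhs (X w) A by exact: open_nbhs_nbhs.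
  have [k] := ltr_add_invr (divr_gt0 eps0 (ltr0n R 2)); rewrite add0r => keps.
  have [i Xi] := eP (X w) k.+1%:R^-1 (ltac:(by rewrite invr_gt0)).
  exists (i, k) => [v /= vi|/=]; last exact: ltW.
  apply: epsA; rewrite -ball_normE /ball_/= -(subrKA (e i)).
  rewrite (le_lt_trans (ler_normD _ _))// (splitr eps) ltrD ?(lt_trans Xi)//.
  by rewrite distrC (le_lt_trans vi).
rewrite bigcup_mkcond; apply: countable_bigcupT_measurable => // ik.
by case: ifP => _ //; apply: mball; rewrite invr_ge0.
Qed.

End weak_measurability.

(** * Convergence of real sequences *)

Definition infinitely_often (P : nat -> Prop) :=
  forall N, exists2 n, (N <= n)%N & P n.

Lemma not_infinitely_often (P : nat -> Prop) :
  ~ infinitely_often P -> \forall n \near \oo, ~ P n.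
Proof.
by move=> /existsNP[N NP]; exists N => // n Nn Pn; apply: NP; exists n.
Qed.

Section real_sequences.
Context {R : realType}.

(** The limit is the upper limit, i.e. the supremum of the levels reached
    infinitely often; a value below it taken infinitely often leaves room for
    two rationals that are crossed infinitely often. *)
Lemma no_oscillation_cvgn (u : nat -> R) (M : R) : (forall n, 0 <= u n <= M) ->
  (forall a b : rat, 0 <= a -> a < b ->
    ~ (infinitely_often (fun n => u n <= ratr a) /\
       infinitely_often (fun n => ratr b <= u n))) -> cvgn u.
Proof.
move=> uM nosc.
pose S := [set t | infinitely_often (fun n => t <= u n)].
have SM : has_ubound S.
  by exists M => t /(_ 0)[n _ tn]; have /andP[_] := uM n; exact: le_trans tn.
have S0 : has_sup S.
  by split=> //; exists 0 => N; exists N => //; have /andP[] := uM N.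
apply/cvg_ex; exists (sup S); apply/cvgrPdist_lt => e e0.
have hi : \forall n \near \oo, ~ (sup S + e / 2 <= u n).
  apply: not_infinitely_often => h.
  have := ub_le_sup SM h; rewrite gerDl => e2; lra.
have lo : \forall n \near \oo, ~ (u n <= sup S - e / 2).
  apply: not_infinitely_often => h.
  have lo0 : 0 <= sup S - e / 2.
    by have [n _] := h 0; apply: le_trans; have /andP[] := uM n.
  have [a] : exists a : rat, ratr a \in `]sup S - e / 2, sup S[.
    by apply: rat_in_itvoo; lra.
  rewrite in_itv/= => /andP[a1 a2].
  have [b] := rat_in_itvoo a2; rewrite in_itv/= => /andP[b1 b2].
  have a0 : 0 <= a by rewrite -(ler0q R) (le_trans lo0)// ltW.
  have ab : a < b by rewrite -(ltr_rat R).
  apply: (nosc a b a0 ab); split=> N.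
    by have [n Nn un] := h N; exists n => //; rewrite (le_trans un)// ltW.
  have sb : 0 < sup S - ratr b by rewrite subr_gt0.
  have [t St bt] := sup_adherent sb S0.
  have [n Nn tn] := St N; exists n => //; apply: le_trans tn; lra.
near=> n.
have /negP : ~ (sup S + e / 2 <= u n) by near: n; exact: hi.
have /negP : ~ (u n <= sup S - e / 2) by near: n; exact: lo.
rewrite -!ltNge => h1 h2; rewrite ltr_norml; lra.
Unshelve. all: by end_near. Qed.

(** Even across jumps of [phi], a pair of levels crossed infinitely often by [r]
    is mapped by [phi] to such a pair for [phi (r n)], so [r] cannot oscillate.
    It is bounded because [phi] tends to infinity. *)
Lemma cvgn_of_increasing (phi : R -> R) (r : nat -> R) :
  (forall s t, 0 <= s -> s < t -> phi s < phi t) ->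
  (phi t @[t --> +oo] --> +oo) ->
  (forall n, 0 <= r n) -> cvgn (fun n => phi (r n)) -> cvgn r.
Proof.
move=> phi_incr phi_oo r0 cphi.
have phi_le s t : 0 <= s -> s <= t -> phi s <= phi t.
  by move=> s0; rewrite le_eqVlt => /predU1P[->//|/(phi_incr _ _ s0)/ltW].
have [K KP] : exists K, forall n, phi (r n) <= K.
  have [K [_ KP]] := cvg_seq_bounded cphi; exists (K + 1) => n.
  by apply: le_trans (ler_norm _) _; apply: KP => //; rewrite ltrDl.
have [T0 [_ TP]] : \forall t \near +oo, K < phi t.
  by move/cvgryPgt : phi_oo; exact.
have rT n : r n <= T0 + 1.
  rewrite leNgt; apply/negP => Tr.
  have := TP (r n) (lt_trans _ Tr); rewrite ltrDl => /(_ ltr01).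
  by rewrite ltNge KP.
apply: (@no_oscillation_cvgn r (T0 + 1)) => [n|a b a0 ab [ra rb]].
  by rewrite r0 rT.
have a0' : 0 <= ratr a :> R by rewrite ler0q.
have ab' : ratr a < ratr b :> R by rewrite ltr_rat.
pose p := limn (fun n => phi (r n)).
have pa : p <= phi (ratr a).
  rewrite leNgt; apply/negP => pa.
  have [N _ NP] := cvgr_gt _ cphi _ pa.
  have [n Nn rn] := ra N.
  by have := NP _ Nn; rewrite /= ltNge phi_le.
have pb : phi (ratr b) <= p.
  rewrite leNgt; apply/negP => pb.
  have [N _ NP] := cvgr_lt _ cphi _ pb.
  have [n Nn rn] := rb N.
  by have := NP _ Nn; rewrite /= ltNge phi_le// (le_trans a0') ?ltW.
by have := phi_incr _ _ a0' ab'; rewrite ltNge (le_trans pb pa).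
Qed.

Lemma nneseries_boundP (u : nat -> R) : (forall n, 0 <= u n) ->
  (\sum_(0 <= n <oo) (u n)%:E < +oo)%E <->
  exists C : R, forall n, \sum_(k < n) u k <= C.
Proof.
move=> u0; have u0' n : (0 <= (u n)%:E)%E by rewrite lee_fin.
have sumE n : (\sum_(0 <= k < n) (u k)%:E = (\sum_(k < n) u k)%:E)%E.
  by rewrite sumEFin big_mkord.
split=> [soo|[C uC]].
  exists (fine (\sum_(0 <= n <oo) (u n)%:E)) => n.
  rewrite -lee_fin fineK; last first.
    by rewrite ge0_fin_numE// nneseries_ge0.
  rewrite -sumE; exact: nneseries_lim_ge.
apply: (@le_lt_trans _ _ C%:E); last by rewrite ltry.
apply: lime_le; first by apply: is_cvg_nneseries.
by apply: nearW => n; rewrite sumE lee_fin.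
Qed.

Lemma cvgn_partial_sums (u : nat -> R) (C : R) : (forall n, 0 <= u n) ->
  (forall n, \sum_(k < n) u k <= C) -> cvgn (fun n => \sum_(k < n) u k).
Proof.
move=> u0 uC; apply: nondecreasing_is_cvgn; last by exists C => _ [n _ <-].
by apply/nondecreasing_seqP => n; rewrite big_ord_recr/= lerDl.
Qed.

(** The factors are at most [expR (chi k)]. *)
Lemma cvgn_partial_products (chi : nat -> R) (C : R) :
  (forall n, 0 <= chi n) -> (forall n, \sum_(k < n) chi k <= C) ->
  cvgn (fun n => \prod_(k < n) (1 + chi k)) /\
  forall n, \prod_(k < n) (1 + chi k) <= expR C.
Proof.
move=> chi0 chiC.
have prod0 n : 0 <= \prod_(k < n) (1 + chi k).
  by apply: prodr_ge0 => k _; rewrite addr_ge0.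
have prodC n : \prod_(k < n) (1 + chi k) <= expR C.
  apply: (@le_trans _ _ (expR (\sum_(k < n) chi k))); last by rewrite ler_expR.
  elim: n => [|n IH]; first by rewrite !big_ord0 expR0.
  rewrite !big_ord_recr/= expRD; apply: ler_pM => //; last exact: expR_ge1Dx.
    exact: prod0.
  by rewrite addr_ge0.
split=> //; apply: nondecreasing_is_cvgn; last by exists (expR C) => _ [n _ <-].
apply/nondecreasing_seqP => n.
by rewrite big_ord_recr/= ler_peMr ?prod0// lerDl.
Qed.

End real_sequences.

(** * Convergence of nonnegative supermartingales *)

Section nonneg_supermartingale.
Context d (Omega : measurableType d) (R : realType) (P : probability Omega R)
  (Fl : nat -> set (set Omega)) (W : nat -> Omega -> R).
Hypothesis Fl_sub : forall n,
  (Fl n).-sigma.-measurable `<=` @measurable d Omega.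
Hypothesis Fl_mono : forall n,
  (Fl n).-sigma.-measurable `<=` (Fl n.+1).-sigma.-measurable.
Hypothesis W_ge0 : forall n w, 0 <= W n w.
Hypothesis W_adapted : forall n, measurable_wrt (Fl n) (W n).
Hypothesis W_super : forall n (A : set Omega), (Fl n).-sigma.-measurable A ->
  (\int[P]_(w in A) (W n.+1 w)%:E <= \int[P]_(w in A) (W n w)%:E)%E.

Let mFl n (A : set Omega) :
  (Fl n).-sigma.-measurable A -> @measurable d Omega A.
Proof. exact: Fl_sub. Qed.

Let Fl_le m n : (m <= n)%N ->
  (Fl m).-sigma.-measurable `<=` (Fl n).-sigma.-measurable.
Proof.
elim: n => [|n IH]; first by rewrite leqn0 => /eqP ->.
rewrite leq_eqVlt => /predU1P[->//|]; rewrite ltnS => /IH mn.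
exact: subset_trans mn (@Fl_mono n).
Qed.

Let mW n : measurable_fun setT (EFin \o W n).
Proof.
apply/measurable_EFinP => _ B mB; apply: mFl.
exact: (W_adapted measurableT mB).
Qed.

Let FlW n (B : set R) : measurable B -> (Fl n).-sigma.-measurable (W n @^-1` B).
Proof.
move=> mB; rewrite -[X in _.-measurable X]setTI.
exact: (W_adapted measurableT).
Qed.

Let above b n := [set w | b <= W n w].
Let below a n := [set w | W n w <= a].

Let Fl_above b n : (Fl n).-sigma.-measurable (above b n).
Proof.
rewrite (_ : above b n = W n @^-1` `[b, +oo[%classic); first exact: FlW.
by apply/seteqP; split=> w /=; rewrite in_itv/= andbT.
Qed.

Let Fl_below a n : (Fl n).-sigma.-measurable (below a n).
Proof.
rewrite (_ : below a n = W n @^-1` `]-oo, a]%classic); first exact: FlW.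
by apply/seteqP; split=> w /=; rewrite in_itv.
Qed.

Let mabove b n : measurable (above b n).
Proof. by apply: (@mFl n); exact: Fl_above. Qed.
Let mbelow a n : measurable (below a n).
Proof. by apply: (@mFl n); exact: Fl_below. Qed.

Let int_ge n (A : set Omega) b :
  (Fl n).-sigma.-measurable A -> 0 <= b -> A `<=` above b n ->
  (b%:E * P A <= \int[P]_(w in A) (W n w)%:E)%E.
Proof.
move=> FA b0 Ab; have mA := mFl FA; rewrite -integral_cst//.
by apply: ge0_le_integral => //=; exact: measurable_funTS (mW n).
Qed.

Let int_le n (A : set Omega) a :
  (Fl n).-sigma.-measurable A -> A `<=` below a n ->
  (\int[P]_(w in A) (W n w)%:E <= a%:E * P A)%E.
Proof.
move=> FA Aa; have mA := mFl FA; rewrite -integral_cst//.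
apply: ge0_le_integral => //=; last exact: measurable_funTS (mW n).
by move=> w _; rewrite lee_fin.
Qed.

(** The maximal inequality over a finite horizon, by induction on the horizon:
    on the part of [A] where [W n] is at least [b] use Markov's inequality, on
    the rest pass to time [n.+1]. *)
Let maximal_horizon N n (A : set Omega) b :
  (Fl n).-sigma.-measurable A -> 0 <= b ->
  (b%:E * P (A `&` \bigcup_(i < N) above b (n + i)%N) <=
   \int[P]_(w in A) (W n w)%:E)%E.
Proof.
elim: N n A => [|N IH] n A FA b0.
  rewrite bigcup_mkord big_ord0 setI0 measure0 mule0.
  by apply: integral_ge0 => w _; rewrite lee_fin.
have mA := mFl FA.
pose A1 : set Omega := A `&` above b n; pose A2 : set Omega := A `\` above b n.
have FA1 : (Fl n).-sigma.-measurable A1 by exact: measurableI.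
have FA2 : (Fl n).-sigma.-measurable A2 by exact: measurableD.
have mA1 := mFl FA1; have mA2 := mFl FA2.
have mU k : measurable (\bigcup_(i < N) above b (k + i)%N).
  by apply: bigcup_measurable => i _.
apply: (@le_trans _ _ (b%:E *
    (P A1 + P (A2 `&` \bigcup_(i < N) above b (n.+1 + i)%N)))%E).
  apply: lee_wpmul2l; first by rewrite lee_fin.
  apply: le_trans (measureU2 _ mA1 (measurableI _ _ mA2 (mU _))).
  apply: le_measure; rewrite ?inE.
  - by apply: measurableI => //; apply: bigcup_measurable.
  - by apply: measurableU => //; exact: measurableI.
  - move=> w [Aw [i iN wi]]; have [wb|nwb] := pselect (above b n w).
      by left.
    right; split=> //; case: i iN wi => [|i] iN wi.
      by rewrite addn0 in wi.
    by exists i => //; rewrite addSnnS.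
rewrite ge0_muleDr//.
have -> : A = A1 `|` A2 by rewrite /A1 /A2 setUIDK.
rewrite ge0_integral_setU//=.
- apply: leeD; first by apply: int_ge => // w [].
  apply: le_trans (W_super FA2); exact: (IH n.+1 A2 (@Fl_mono n _ FA2) b0).
- exact: measurable_funTS (mW n).
- by move=> w _; rewrite lee_fin.
- by apply/disj_setPS => w [[_ +] [_]].
Qed.

Lemma maximal_inequality n (A : set Omega) b :
  (Fl n).-sigma.-measurable A -> 0 <= b ->
  (b%:E * P (A `&` \bigcup_i above b (n + i)%N) <=
   \int[P]_(w in A) (W n w)%:E)%E.
Proof.
move=> FA b0; have mA := mFl FA.
pose D N : set Omega := A `&` \bigcup_(i < N) above b (n + i)%N.
have DU : A `&` \bigcup_i above b (n + i)%N = \bigcup_N D N.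
  apply/seteqP; split=> [w [Aw [i _ wi]]|w [N _ [Aw [i iN wi]]]].
    by exists i.+1 => //; split=> //; exists i => //=.
  by split=> //; exists i.
have mD N : measurable (D N).
  by apply: measurableI => //; apply: bigcup_measurable => i _; exact: mabove.
have Dcvg : P (D N) @[N --> \oo] --> P (\bigcup_N D N).
  apply: nondecreasing_cvg_mu; [by []|exact: bigcupT_measurable|].
  apply/nondecreasing_seqP => N; apply/subsetPset => w [Aw [i iN wi]].
  by split=> //; exists i => //; exact: leqW.
rewrite DU.
have bD : (b%:E * P (D N))%E @[N --> \oo] --> (b%:E * P (\bigcup_N D N))%E.
  by apply: cvgeZl.
by apply: (cvge_to_le bD); apply: nearW => N; exact: maximal_horizon.
Qed.

(** Decomposition at the first entrance, after time [n], in the adapted sets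
    [B i]: a bound on the conditional probability of [E] at each time of
    entrance gives the same bound at time [n]. *)
Lemma first_entrance (E : set Omega) (B : nat -> set Omega) (K : R) n
    (A : set Omega) :
  measurable E -> (forall i, (Fl i).-sigma.-measurable (B i)) -> 0 <= K ->
  (forall i (D : set Omega), (Fl i).-sigma.-measurable D -> D `<=` B i ->
    (P (D `&` E) <= K%:E * P D)%E) ->
  E `<=` \bigcup_i B (n + i)%N -> (Fl n).-sigma.-measurable A ->
  (P (A `&` E) <= K%:E * P (A `&` \bigcup_i B (n + i)%N))%E.
Proof.
move=> mE FB K0 EB EsubB FA.
pose D i : set Omega := A `&` seqDU (fun i => B (n + i)%N) i.
have FD i : (Fl (n + i)%N).-sigma.-measurable (D i).
  apply: measurableI; first by apply: Fl_le FA; exact: leq_addr.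
  apply: measurableD => //; apply: bigsetU_measurable => j _.
  by apply: Fl_le (FB (n + j)%N); rewrite leq_add2l ltnW.
have tD : trivIset setT D by apply: trivIset_setIl; exact: trivIset_seqDU.
have DU : A `&` \bigcup_i B (n + i)%N = \bigcup_i D i.
  by rewrite seqDU_bigcup_eq setI_bigcupr.
have AE : A `&` E = \bigcup_i (D i `&` E).
  rewrite -setI_bigcupl -DU; apply/seteqP; split=> w; last by move=> [[]].
  by move=> [Aw Ew]; do 2!split=> //; exact: EsubB.
have mD i : measurable (D i) := mFl (FD i).
have mDE i : measurable (D i `&` E) by exact: measurableI.
have tDE : trivIset setT (fun i => D i `&` E) by exact: trivIset_setIr.
rewrite DU AE (measure_bigcup P setT (fun i => D i `&` E))//.
rewrite (measure_bigcup P setT D)//.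
rewrite -nneseriesZl//; apply: lee_nneseries => // i _.
by apply: (EB _ _ (FD i)) => w [_ []].
Qed.

Let oscillation a b := [set w | infinitely_often (fun n => W n w <= a) /\
  infinitely_often (fun n => b <= W n w)].

Let moscillation a b : measurable (oscillation a b).
Proof.
have -> : oscillation a b =
    (\bigcap_N \bigcup_(n in [set n | (N <= n)%N]) below a n) `&`
    (\bigcap_N \bigcup_(n in [set n | (N <= n)%N]) above b n).
  apply/seteqP; split=> w [wa wb]; split=> N.
  - by have [n ? ?] := wa N; exists n.
  - by have [n ? ?] := wb N; exists n.
  - by have [n ? ?] := wa N I; exists n.
  - by have [n ? ?] := wb N I; exists n.
apply: measurableI; apply: bigcapT_measurable => N;
  by apply: bigcup_measurable.
Qed.

(** Dubins' inequality. After a time at which [W <= a], the maximal inequality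
    bounds the conditional probability of ever reaching [b] by [a / b]; since
    the event of infinite oscillation does not depend on the first terms, this
    can be repeated from each time of entrance. *)
Lemma oscillation_bound a b k n (A : set Omega) : 0 <= a -> a < b ->
  (Fl n).-sigma.-measurable A ->
  (P (A `&` oscillation a b) <= ((a / b) ^+ k)%:E * P A)%E.
Proof.
move=> a0 ab; have b0 : 0 < b by exact: le_lt_trans ab.
have r0 : 0 <= a / b by rewrite divr_ge0// ltW.
elim: k n A => [|k IH] n A FA.
  rewrite expr0 mul1e; apply: le_measure; rewrite ?inE; last by move=> w [].
    by apply: measurableI => //; exact: mFl FA.
  exact: mFl FA.
have from_below m (D : set Omega) :
    (Fl m).-sigma.-measurable D -> D `<=` below a m ->
    (P (D `&` oscillation a b) <= ((a / b) ^+ k.+1)%:E * P D)%E.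
  move=> FD Da.
  apply: (@le_trans _ _ (((a / b) ^+ k)%:E *
      P (D `&` \bigcup_i above b (m + i)%N))%E).
    apply: (first_entrance (@moscillation a b) (@Fl_above b)
      (exprn_ge0 k r0) _ _ FD).
      by move=> i C FC _; exact: (IH i).
    by move=> w [_ /(_ m)[j mj wj]]; exists (j - m)%N => //; rewrite subnKC.
  rewrite exprSr EFinM -muleA; apply: lee_wpmul2l.
    by rewrite lee_fin exprn_ge0.
  rewrite mulrC EFinM -muleA lee_pdivlMl//.
  apply: le_trans (maximal_inequality FD (ltW b0)) _; exact: int_le.
apply: (@le_trans _ _ (((a / b) ^+ k.+1)%:E *
    P (A `&` \bigcup_i below a (n + i)%N))%E).
  apply: (first_entrance (@moscillation a b) (@Fl_below a)
    (exprn_ge0 k.+1 r0) from_below _ FA).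
  by move=> w [/(_ n)[j mj wj] _]; exists (j - n)%N => //; rewrite subnKC.
apply: lee_wpmul2l; first by rewrite lee_fin exprn_ge0.
apply: le_measure; rewrite ?inE; last by move=> w [].
  apply: measurableI; first exact: mFl FA.
  by apply: bigcupT_measurable.
exact: mFl FA.
Qed.

Let oscillation_null a b : 0 <= a -> a < b -> P (oscillation a b) = 0%E.
Proof.
move=> a0 ab; have b0 : 0 < b by exact: le_lt_trans ab.
apply/eqP; rewrite eq_le measure_ge0 andbT.
have Pk k : (P (oscillation a b) <= ((a / b) ^+ k)%:E)%E.
  have := @oscillation_bound a b k 0 setT a0 ab measurableT.
  by rewrite setTI probability_setT mule1.
have rk : ((a / b) ^+ k)%:E @[k --> \oo] --> 0%:E.
  apply: cvg_EFin; first by apply: nearW.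
  apply: cvg_expr; rewrite ger0_norm ?divr_ge0// ?ltW//.
  by rewrite ltr_pdivrMr// mul1r.
by apply: (cvge_to_ge rk); apply: nearW => k; exact: Pk.
Qed.

Let unbounded K := below K 0 `&` \bigcap_(b : nat) \bigcup_i above b%:R i.

Let unbounded_null (K : nat) : P (unbounded K%:R) = 0%E.
Proof.
have mU : measurable (unbounded K%:R).
  apply: measurableI => //; apply: bigcapT_measurable => b.
  by apply: bigcupT_measurable.
apply/eqP; rewrite eq_le measure_ge0 andbT.
have Pb (b : nat) : (P (unbounded K%:R) <= (K%:R / b.+1%:R)%:E)%E.
  rewrite mulrC EFinM lee_pdivlMl//.
  apply: (@le_trans _ _ (b.+1%:R%:E *
      P (below K%:R 0 `&` \bigcup_i above b.+1%:R (0 + i)%N))%E).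
    apply: lee_wpmul2l; first by rewrite lee_fin.
    apply: le_measure; rewrite ?inE//.
      by apply: measurableI => //; apply: bigcupT_measurable.
    by move=> w [wK /(_ b.+1 I) wb].
  have FK := @Fl_below K%:R 0.
  apply: le_trans (maximal_inequality FK (ler0n R b.+1)) _.
  apply: le_trans (int_le FK (@subset_refl _ _)) _.
  rewrite -[leRHS]mule1; apply: lee_wpmul2l; first by rewrite lee_fin.
  exact: probability_le1.
have Kb : (K%:R / b.+1%:R)%:E @[b --> \oo] --> (K%:R * 0 : R)%:E.
  apply: cvg_EFin; first by apply: nearW.
  by apply: cvgM; [exact: cvg_cst|exact: cvg_harmonic].
rewrite mulr0 in Kb.
by apply: (cvge_to_ge Kb); apply: nearW => k; exact: Pb.
Qed.

(** The paths are almost surely bounded, by the maximal inequality on the events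
    [W 0 <= K], and almost surely do not oscillate between two rationals. *)
Theorem nonneg_supermartingale_cvg : {ae P, forall w, cvgn (fun n => W n w)}.
Proof.
have ae_bnd : {ae P, forall w, forall K : nat, ~ unbounded K%:R w}.
  apply: ae_foralln => K; exists (unbounded K%:R); split; last first.
  - by move=> w /=; rewrite notK.
  - exact: unbounded_null.
  - apply: measurableI => //; apply: bigcapT_measurable => b.
    by apply: bigcupT_measurable.
have ae_osc : {ae P, forall w, forall k : nat, forall ab : rat * rat,
    unpickle k = Some ab -> 0 <= ab.1 -> ab.1 < ab.2 ->
    ~ oscillation (ratr ab.1) (ratr ab.2) w}.
  apply: ae_foralln => k; case: unpickle => [[a b]|]; last by apply: aeW.
  have [/andP[a0 ab]|nab] := boolP ((0 <= a) && (a < b)); last first.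
    by apply: aeW => w _ [<-] a0 ab; rewrite a0 ab in nab.
  exists (oscillation (ratr a) (ratr b)); split => //.
    by apply: oscillation_null; [rewrite ler0q|rewrite ltr_rat].
  by move=> w /=; apply: contra_notP => h _ [<-].
apply: filterS2 ae_bnd ae_osc => w wbnd wosc.
have [M WM] : exists M : nat, forall n, W n w <= M%:R.
  apply: contrapT => noM; apply: (wbnd (Num.truncn (W 0 w)).+1).
  split; first by rewrite /below/= ltW// truncnS_gt.
  move=> b _; apply: contrapT => nob; apply: noM; exists b => n.
  by rewrite leNgt; apply/negP => h; apply: nob; exists n => //; exact: ltW.
apply: (@no_oscillation_cvgn _ _ M%:R) => [n|a b a0 ab].
  by rewrite W_ge0 WM.
exact: (wosc (pickle (a, b)) (a, b) (pickleK _)).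
Qed.

End nonneg_supermartingale.

(** * Conditional expectations in [0, +oo] *)

Section conditional_expectation.
Context d (Omega : measurableType d) (R : realType) (P : probability Omega R)
  (G : set (set Omega)).
Hypothesis G_sub : G.-sigma.-measurable `<=` @measurable d Omega.
Hypothesis G_sigma : G.-sigma.-measurable `<=` G.

Lemma measurable_wrt_fun d' (U : measurableType d') (f : Omega -> U) :
  measurable_wrt G f -> measurable_fun setT f.
Proof. by move=> mf _ B mB; apply: G_sub; exact: (mf measurableT B mB). Qed.

Import HBNNSimple.

Let integral_nnsfunM (s : {nnsfun (g_sigma_algebraType G) >-> R})
    (h : Omega -> \bar R) (A : set Omega) :
  measurable A -> measurable_fun setT h -> (forall w, 0 <= h w)%E ->
  (\int[P]_(w in A) ((s w)%:E * h w) =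
   \sum_(y \in range s) (y%:E * \int[P]_(w in A `&` s @^-1` [set y]) h w))%E.
Proof.
move=> mA mh h0.
have sE w : ((s w)%:E * h w = \sum_(y \in range s)
    (y * \1_(s @^-1` [set y]) w)%:E * h w)%E.
  rewrite {1}(fimfunE s w) -fsumEFin; last exact: fimfunP.
  rewrite ge0_mule_fsuml// => y; rewrite lee_fin.
  have [y0|y0] := leP 0 y; first by rewrite mulr_ge0.
  rewrite indicE memNset ?mulr0//= => sy.
  by move: y0; rewrite -sy ltNge fun_ge0.
under eq_integral do rewrite sE.
have ms y : measurable (s @^-1` [set y] : set Omega).
  by apply: G_sub; exact: measurable_sfunP.
have term_ge0 y w : (0 <= (y * \1_(s @^-1` [set y]) w)%:E * h w)%E.
  apply: mule_ge0 => //; rewrite lee_fin indicE.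
  have [|] := boolP (w \in _); last by rewrite mulr0.
  by rewrite inE/= => <-; rewrite mulr1 fun_ge0.
have mterm y : measurable_fun A
    (fun w => (y * \1_(s @^-1` [set y]) w)%:E * h w)%E.
  apply: emeasurable_funM; last exact: measurable_funTS.
  apply/measurable_EFinP; apply: measurable_funM => //.
rewrite ge0_integral_fsum//.
apply: eq_fsbigr => y; rewrite inE => -[w _ <-{y}].
have y0 : 0 <= s w by exact: fun_ge0.
rewrite -ge0_integralZl//; [|exact: measurableI|exact: measurable_funTS].
rewrite integral_mkcondr; apply: eq_integral => v _.
rewrite epatch_indic/= EFinM -!muleA; congr (_ * _)%E; exact: muleC.
Qed.

(** When [g] is simple, both sides are the same combination of integrals over
    sets of [G]; the general case follows by monotone convergence. *)
Lemma cond_exp_pull_out (f Y : Omega -> \bar R) (g : Omega -> R)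
    (A : set Omega) :
  measurable_fun setT f -> (forall w, 0 <= f w)%E -> is_cond_exp P G f Y ->
  measurable_wrt G g -> (forall w, 0 <= g w) -> G.-sigma.-measurable A ->
  (\int[P]_(w in A) ((g w)%:E * f w) = \int[P]_(w in A) ((g w)%:E * Y w))%E.
Proof.
move=> mf f0 [GY Y0 YE] Gg g0 GA.
have mA := G_sub GA; have mY := measurable_wrt_fun GY.
have mg : measurable_fun setT (EFin \o g : g_sigma_algebraType G -> \bar R).
  exact/measurable_EFinP.
pose s := nnsfun_approx measurableT mg.
have sg w : (s n w)%:E @[n --> \oo] --> (g w)%:E.
  by apply: (@cvg_nnsfun_approx _ _ _ setT) => // v _; rewrite lee_fin.
have nd_s w m n : (m <= n)%N -> s m w <= s n w.
  by move=> mn; have /lefP := nd_nnsfun_approx measurableT mg mn; exact.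
have ms n : measurable_fun setT (EFin \o s n : Omega -> \bar R).
  by apply: measurable_wrt_fun; exact/measurable_EFinP.
have approx (h : Omega -> \bar R) : measurable_fun setT h ->
    (forall w, 0 <= h w)%E -> (\int[P]_(w in A) ((g w)%:E * h w) =
    limn (fun n => \int[P]_(w in A) ((s n w)%:E * h w)))%E.
  move=> mh h0; rewrite -monotone_convergence//.
  - apply: eq_integral => w _; apply/esym/cvg_lim => //.
    have [gh|] := boolP ((g w)%:E *? h w)%E.
      by apply: cvgeM; [exact: gh|exact: sg|exact: cvg_cst].
    (* the product may jump only where [g w = 0] and [h w = +oo] *)
    rewrite mule_defE andbF orbF negbK.
    move=> /andP[/eqP[gw0] _]; rewrite gw0 mul0e.
    rewrite (_ : (fun n => _) = cst 0%E); first exact: cvg_cst.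
    apply/funext => n; suff -> : s n w = 0 by rewrite mul0e.
    apply/eqP; rewrite eq_le fun_ge0 andbT -gw0 -lee_fin.
    apply: (cvge_to_ge (sg w)).
    exact: (ex_intro2 _ _ n I (fun m nm => nd_s w n m nm)).
  - move=> n; apply: emeasurable_funM; apply: measurable_funTS => //.
    exact: ms.
  - by move=> n w _; rewrite mule_ge0// lee_fin.
  - by move=> w _ m n /(nd_s w) smn; apply: lee_wpmul2r => //; rewrite lee_fin.
rewrite !approx//; congr (limn _); apply/funext => n.
rewrite !integral_nnsfunM//; apply: eq_fsbigr => y _; congr (_ * _)%E.
by rewrite YE//; apply: G_sigma; exact: measurableI.
Qed.

End conditional_expectation.

(** * The Robbins-Siegmund theorem *)

Section Robbins_Siegmund.
Context d (Omega : measurableType d) (R : realType) (P : probability Omega R)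
  (Fl : nat -> set (set Omega)) (V chi theta eta : nat -> Omega -> R)
  (Y : nat -> Omega -> \bar R).
Hypothesis Fl_sub : forall n,
  (Fl n).-sigma.-measurable `<=` @measurable d Omega.
Hypothesis Fl_sigma : forall n, (Fl n).-sigma.-measurable `<=` Fl n.
Hypothesis Fl_mono : forall n,
  (Fl n).-sigma.-measurable `<=` (Fl n.+1).-sigma.-measurable.
Hypothesis V_ell : ell_plus Fl V.
Hypothesis chi_ell : ell1_plus P Fl chi.
Hypothesis theta_ell : ell_plus Fl theta.
Hypothesis eta_ell : ell1_plus P Fl eta.
Hypothesis Y_cond_exp : forall n,
  is_cond_exp P (Fl n) (fun w => (V n.+1 w)%:E) (Y n).
Hypothesis Y_le : {ae P, forall w, forall n,
  (Y n w + (theta n w)%:E <= ((1 + chi n w) * V n w + eta n w)%:E)%E}.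

Let V0 n w : 0 <= V n w. Proof. by have [] := V_ell n. Qed.
Let chi0 n w : 0 <= chi n w. Proof. by have [] := chi_ell.1 n. Qed.
Let theta0 n w : 0 <= theta n w. Proof. by have [] := theta_ell n. Qed.
Let eta0 n w : 0 <= eta n w. Proof. by have [] := eta_ell.1 n. Qed.

Let wrtS n (f : Omega -> R) :
  measurable_wrt (Fl n) f -> measurable_wrt (Fl n.+1) f.
Proof. by move=> mf _ B mB; apply: Fl_mono; exact: (mf measurableT B mB). Qed.

(** Dividing by [growth n] turns the factor [1 + chi n] into [1]. *)
Let growth n w := \prod_(k < n) (1 + chi k w).
Let gain n w := \sum_(k < n) theta k w / growth k.+1 w.
Let loss n w := \sum_(k < n) eta k w / growth k.+1 w.

Let growthS n w : growth n.+1 w = growth n w * (1 + chi n w).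
Proof. by rewrite /growth big_ord_recr. Qed.

Let growth_ge1 n w : 1 <= growth n w.
Proof.
elim: n => [|n IH]; first by rewrite /growth big_ord0.
by rewrite growthS (le_trans IH)// ler_peMr ?(le_trans ler01)// lerDl.
Qed.

Let growth_gt0 n w : 0 < growth n w.
Proof. exact: lt_le_trans (growth_ge1 n w). Qed.

Let lossS n w : loss n.+1 w = loss n w + eta n w / growth n.+1 w.
Proof. by rewrite /loss big_ord_recr. Qed.

Let gainS n w : gain n.+1 w = gain n w + theta n w / growth n.+1 w.
Proof. by rewrite /gain big_ord_recr. Qed.

Let gain_ge0 n w : 0 <= gain n w.
Proof. by apply: sumr_ge0 => k _; rewrite divr_ge0// ltW. Qed.

Let loss_le n w : loss n w <= loss n.+1 w.
Proof. by rewrite lossS lerDl divr_ge0// ltW. Qed.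

Let growth_wrt n : measurable_wrt (Fl n) (growth n.+1).
Proof.
have chi_wrt k : measurable_wrt (Fl k) (chi k) by have [] := chi_ell.1 k.
elim: n => [|n IH].
  rewrite (_ : growth 1 = fun w => 1 + chi 0 w).
    by apply: measurable_funD => //; exact: chi_wrt.
  by apply/funext => w; rewrite /growth big_ord1.
rewrite (_ : growth n.+2 = fun w => growth n.+1 w * (1 + chi n.+1 w));
  last first.
  by apply/funext => w; rewrite growthS.
apply: measurable_funM; first exact: wrtS.
by apply: measurable_funD => //; exact: chi_wrt.
Qed.

Let growthV_wrt n : measurable_wrt (Fl n) (fun w => (growth n.+1 w)^-1).
Proof.
rewrite (_ : (fun w => _) = (@powR R ^~ (-1)) \o growth n.+1).
  by apply: measurableT_comp; [exact: measurable_powR|exact: growth_wrt].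
by apply/funext => w; rewrite /= powR_inv1// ltW.
Qed.

Let sum_wrt (u : nat -> Omega -> R) n : ell_plus Fl u ->
  measurable_wrt (Fl n) (fun w => \sum_(k < n.+1) u k w / growth k.+1 w).
Proof.
move=> u_ell; elim: n => [|n IH].
  under eq_fun do rewrite big_ord1.
  by apply: measurable_funM; [have [] := u_ell 0%N|exact: growthV_wrt].
under eq_fun do rewrite big_ord_recr/=.
apply: measurable_funD; first exact: wrtS.
by apply: measurable_funM; [have [] := u_ell n.+1|exact: growthV_wrt].
Qed.

Let gain_wrt n : measurable_wrt (Fl n) (gain n.+1).
Proof. exact: sum_wrt. Qed.

Let loss_wrt n : measurable_wrt (Fl n) (loss n.+1).
Proof. exact: sum_wrt eta_ell.1. Qed.

(** Killing at [0] once the losses exceed [m] keeps the compensated process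
    nonnegative. It preserves the supermartingale property because the event
    [loss n.+1 <= m] is already known at time [n]. *)
Let W (m : nat) n w :=
  if loss n w <= m%:R then V n w / growth n w + gain n w + (m%:R - loss n w)
  else 0.

Let W_ge0 m n w : 0 <= W m n w.
Proof.
rewrite /W; case: ifPn => // lm.
by rewrite addr_ge0 ?subr_ge0// addr_ge0// divr_ge0// ltW.
Qed.

Let W_wrt m n : measurable_wrt (Fl n) (W m n).
Proof.
have gW : measurable_wrt (Fl n) (growth n).
  case: n => [|n]; last by apply: wrtS; exact: growth_wrt.
  rewrite (_ : growth 0 = cst 1); first exact: measurable_cst.
  by apply/funext => w; rewrite /growth big_ord0.
have gVW : measurable_wrt (Fl n) (fun w => (growth n w)^-1).
  case: n {gW} => [|n]; last by apply: wrtS; exact: growthV_wrt.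
  rewrite (_ : (fun w => _) = cst 1); first exact: measurable_cst.
  by apply/funext => w; rewrite /growth big_ord0 invr1.
have lW : measurable_wrt (Fl n) (loss n).
  case: n {gW gVW} => [|n]; last by apply: wrtS; exact: loss_wrt.
  rewrite (_ : loss 0 = cst 0); first exact: measurable_cst.
  by apply/funext => w; rewrite /loss big_ord0.
have aW : measurable_wrt (Fl n) (gain n).
  case: n {gW gVW lW} => [|n]; last by apply: wrtS; exact: gain_wrt.
  rewrite (_ : gain 0 = cst 0); first exact: measurable_cst.
  by apply/funext => w; rewrite /gain big_ord0.
apply: measurable_fun_ifT => //.
  by apply: measurable_fun_ler => //; exact: lW.
apply: measurable_funD; last by apply: measurable_funB => //; exact: lW.
apply: measurable_funD; last exact: aW.
by apply: measurable_funM; [have [] := V_ell n|exact: gVW].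
Qed.

Let mwrt n (f : Omega -> R) : measurable_wrt (Fl n) f ->
  measurable_fun setT (EFin \o f).
Proof.
move=> mf; apply/measurable_EFinP.
by apply: measurable_wrt_fun mf; exact: Fl_sub.
Qed.

Let W_super m n (A : set Omega) : (Fl n).-sigma.-measurable A ->
  (\int[P]_(w in A) (W m n.+1 w)%:E <= \int[P]_(w in A) (W m n w)%:E)%E.
Proof.
move=> FA; have mA : measurable A by exact: (@Fl_sub n).
pose B := [set w | loss n.+1 w <= m%:R].
pose C w := gain n.+1 w + (m%:R - loss n.+1 w).
have FB : (Fl n).-sigma.-measurable B.
  rewrite (_ : B = loss n.+1 @^-1` `]-oo, m%:R]%classic); last first.
    by apply/seteqP; split=> w /=; rewrite in_itv.
  rewrite -[X in _.-measurable X]setTI.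
  by apply: (@loss_wrt n measurableT); exact: measurable_itv.
have mB : measurable B by exact: (@Fl_sub n).
have C_wrt : measurable_wrt (Fl n) C.
  apply: measurable_funD; first exact: gain_wrt.
  by apply: measurable_funB => //; exact: loss_wrt.
have C0 w : B w -> 0 <= C w.
  by move=> Bw; rewrite addr_ge0// subr_ge0.
pose D := A `&` B.
have FD : (Fl n).-sigma.-measurable D by exact: measurableI.
have mD : measurable D by exact: measurableI.
have [Y_wrt Y0 _] := Y_cond_exp n.
have mY : measurable_fun setT (Y n).
  by apply: measurable_wrt_fun Y_wrt; exact: Fl_sub.
have mV : measurable_fun setT (fun w => (V n.+1 w)%:E).
  by have [_ /mwrt] := V_ell n.+1.
have mc := mwrt (@growthV_wrt n).
have c0 w : (0 <= (growth n.+1 w)^-1%:E)%E by rewrite lee_fin invr_ge0 ltW.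
have WB w : (W m n.+1 w)%:E =
    ((fun w => (growth n.+1 w)^-1%:E * (V n.+1 w)%:E + (C w)%:E)%E \_ B) w.
  rewrite patchE /W; have [Bw|nBw] := pselect (B w).
    by rewrite mem_set// ifT// -EFinM -EFinD -addrA mulrC.
  by rewrite memNset// ifF//; apply/negP.
under eq_integral do rewrite WB.
rewrite -integral_mkcondr -/D.
have mcV : measurable_fun D (fun w => (growth n.+1 w)^-1%:E * (V n.+1 w)%:E)%E.
  by apply: emeasurable_funM; exact: measurable_funTS.
have mcY : measurable_fun D (fun w => (growth n.+1 w)^-1%:E * Y n w)%E.
  by apply: emeasurable_funM; exact: measurable_funTS.
have mC : measurable_fun D (EFin \o C).
  by apply: measurable_funTS; exact: mwrt C_wrt.
(* only the first summand depends on time [n.+1] *)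
rewrite ge0_integralD//; last 2 first.
- by move=> w _; rewrite mule_ge0// lee_fin.
- by move=> w [_ Bw]; rewrite lee_fin C0.
rewrite (cond_exp_pull_out (@Fl_sub n) (@Fl_sigma n) mV _ (Y_cond_exp n)
  (@growthV_wrt n) _ FD); last 2 first.
- by move=> w; rewrite lee_fin.
- by move=> w; rewrite invr_ge0 ltW.
rewrite -ge0_integralD//; last 2 first.
- by move=> w _; rewrite mule_ge0.
- by move=> w [_ Bw]; rewrite lee_fin C0.
have mW : measurable_fun setT (EFin \o W m n) by exact: mwrt (@W_wrt m n).
apply: (@le_trans _ _ (\int[P]_(w in D) (W m n w)%:E)%E); last first.
  apply: (ge0_subset_integral P mD mA (measurable_funTS mW)).
    by move=> w _; rewrite lee_fin.
  by move=> w [].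
apply: ae_ge0_le_integral => //.
- by move=> w [_ Bw]; rewrite adde_ge0 ?mule_ge0// lee_fin C0.
- exact: emeasurable_funD.
- by move=> w _; rewrite lee_fin.
- exact: measurable_funTS.
apply: filterS Y_le => w /(_ n) Yw [_ Bw].
have Bw' : loss n w <= m%:R by exact: le_trans Bw.
move: (Y0 w) Yw; case: (Y n w) => [y| |]//; rewrite lee_fin => y0.
rewrite -EFinD lee_fin => yw.
rewrite -EFinM -EFinD lee_fin /W Bw' /C gainS lossS growthS.
have g0 := growth_gt0 n w; have h0 : 0 < 1 + chi n w by rewrite ltr_wpDr.
set a := growth n w in g0 *; set h := 1 + chi n w in h0 yw *.
have -> : V n w / a = (h * V n w) / (a * h) by field; rewrite !gt_eqF.
have ah0 : 0 < (a * h)^-1 by rewrite invr_gt0 mulr_gt0.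
have := ler_wpM2r (ltW ah0) yw; lra.
Qed.

(** Almost surely the total loss is finite, so that [W m] is not killed for [m]
    large; its convergence bounds the gains, which therefore converge, and then
    the discounted process converges too. The product of the factors
    [1 + chi k] has a finite limit, which removes the discount. *)
Theorem almost_supermartingale_cvg :
  {ae P, forall w, cvgn (fun n => V n w) /\
    (\sum_(0 <= n <oo) (theta n w)%:E < +oo)%E}.
Proof.
have W_cvg : {ae P, forall w, forall m, cvgn (fun n => W m n w)}.
  apply: ae_foralln => m.
  exact: (nonneg_supermartingale_cvg Fl_sub Fl_mono (W_ge0 m) (W_wrt m)
    (@W_super m)).
apply: filterS3 W_cvg chi_ell.2 eta_ell.2 => w cW.
move=> /(nneseries_boundP (fun n => chi0 n w))[cchi chiC].
move=> /(nneseries_boundP (fun n => eta0 n w))[ceta etaC].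
have [growth_cvg growthC] := cvgn_partial_products (fun n => chi0 n w) chiC.
pose m := (Num.truncn ceta).+1.
have lossC n : loss n w <= ceta.
  apply: le_trans (etaC n); apply: ler_sum => k _.
  by rewrite ler_pdivrMr// ler_peMr// growth_ge1.
have WE n : W m n w = V n w / growth n w + gain n w + (m%:R - loss n w).
  by rewrite /W ifT// (le_trans (lossC n))// ltW// truncnS_gt.
have [K gainK] : exists K, forall n, gain n w <= K.
  have [K [_ KP]] := cvg_seq_bounded (cW m); exists (K + 1) => n.
  have := KP (K + 1) (ltac:(by rewrite ltrDl)) n I.
  apply: le_trans; rewrite /= ger0_norm// WE -addrA addrCA lerDl addr_ge0//.
    by rewrite divr_ge0// ltW.
  by rewrite subr_ge0 (le_trans (lossC n))// ltW// truncnS_gt.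
have gain_cvg : cvgn (fun n => gain n w).
  apply: (@cvgn_partial_sums _ (fun k => theta k w / growth k.+1 w) K) => // k.
  by rewrite divr_ge0// ltW.
have loss_cvg : cvgn (fun n => loss n w).
  apply: (@cvgn_partial_sums _ (fun k => eta k w / growth k.+1 w) ceta) => // k.
  by rewrite divr_ge0// ltW.
split.
  have -> : (fun n => V n w) = (fun n =>
      (W m n w - gain n w - (m%:R - loss n w)) * growth n w).
    apply/funext => n; rewrite WE; have := growth_gt0 n w => g0.
    by field; rewrite gt_eqF.
  have [lW cvgW] := (cvg_ex _).1 (cW m).
  have [lg cvgg] := (cvg_ex _).1 gain_cvg.
  have [ll cvgl] := (cvg_ex _).1 loss_cvg.
  have [la cvga] := (cvg_ex _).1 growth_cvg.
  apply/cvg_ex; exists ((lW - lg - (m%:R - ll)) * la).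
  exact: (cvgM (cvgB (cvgB cvgW cvgg) (cvgB (cvg_cst _) cvgl)) cvga).
apply/nneseries_boundP => //; exists (K * expR cchi) => n.
apply: (@le_trans _ _ (gain n w * expR cchi)); last first.
  by rewrite ler_wpM2r// expR_ge0.
rewrite mulr_suml; apply: ler_sum => k _.
rewrite -mulrA ler_peMr//.
by rewrite mulrC ler_pdivlMr ?mul1r ?growthC.
Qed.

End Robbins_Siegmund.

(** * The natural filtration *)

Section natural_filtration.
Context {R : realType} {H : normedModType R} d (Omega : measurableType d)
  (x : nat -> Omega -> H).

Lemma continuous_borel_measurable (f : H -> R) :
  continuous f -> measurable_fun setT (f : borel H -> R).
Proof.
move=> cf; apply: (@measurability _ _ (borel H) R setT f (@RGenOInfty.G R)).
  exact: RGenOInfty.measurableE.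
move=> _ [_ [a ->] <-]; apply: sub_sigma_algebra; rewrite setTI.
by apply: open_comp => // v _; exact: cf.
Qed.

Let sub_natural_filtration n (S : set (set Omega)) : sigma_algebra setT S ->
  (forall i, (i <= n)%N -> forall B : set (borel H), measurable B ->
    S (x i @^-1` B)) ->
  natural_filtration x n `<=` S.
Proof.
move=> sS xS; apply: smallest_sub => // A.
rewrite -bigcup_mkord_ord => -[i _ [B mB <-]]; rewrite setTI.
by apply: xS => //; rewrite -ltnS.
Qed.

Lemma natural_filtration_sigma n :
  (natural_filtration x n).-sigma.-measurable `<=` natural_filtration x n.
Proof.
by apply: smallest_sub => //; exact: smallest_sigma_algebra.
Qed.

Let natural_filtration_gen n i (B : set (borel H)) : (i <= n)%N ->
  measurable B -> natural_filtration x n (x i @^-1` B).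
Proof.
rewrite -ltnS => ni mB; apply: sub_sigma_algebra.
rewrite -bigcup_mkord_ord; exists i => //; exists B => //.
by rewrite inordK// setTI.
Qed.

Lemma natural_filtration_mono n :
  (natural_filtration x n).-sigma.-measurable `<=`
  (natural_filtration x n.+1).-sigma.-measurable.
Proof.
move=> A /natural_filtration_sigma; apply: sub_natural_filtration => //.
  exact: smallest_sigma_algebra.
move=> i ni B mB; apply: sub_sigma_algebra.
by apply: natural_filtration_gen => //; exact: leqW.
Qed.

Lemma natural_filtration_sub n : (forall n, random_vector (x n)) ->
  (natural_filtration x n).-sigma.-measurable `<=` @measurable d Omega.
Proof.
move=> x_rv A /natural_filtration_sigma; apply: sub_natural_filtration => //.
  exact: sigma_algebra_measurable.
by move=> i _ B mB; rewrite -[X in measurable X]setTI; exact: x_rv.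
Qed.

Lemma natural_filtration_adapted n (f : H -> R) : continuous f ->
  measurable_wrt (natural_filtration x n) (f \o x n).
Proof.
move=> /continuous_borel_measurable mf _ B mB; apply: sub_sigma_algebra.
rewrite setTI comp_preimage; apply: natural_filtration_gen => //.
by rewrite -[X in measurable X]setTI; exact: mf.
Qed.

End natural_filtration.

(** * Fejer sequences *)

Lemma increasing_seq_cvg_infty (k : nat -> nat) :
  increasing_seq k -> k n @[n --> \oo] --> \oo.
Proof.
move=> kincr A [N _ NA]; exists N => // n /= Nn; apply: NA => /=.
have kS m : (k m < k m.+1)%N := (increasing_seqP k).2 kincr m.
by apply: leq_trans Nn _; elim: n => // n nk; exact: leq_ltn_trans (kS n).
Qed.

Section Fejer_paths.
Context {R : realType} {H : completeNormedModType R} (F : set H).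

Definition Fejer_path (y : nat -> H) :=
  forall z, F z -> cvgn (fun n => `|y n - z|).

(** [`|y n - z|] is within [`|z - f i|] of a convergent sequence, for [f i]
    arbitrarily close to [z], hence is Cauchy. *)
Lemma Fejer_path_dense (f : nat -> H) (y : nat -> H) :
  (forall z eps, F z -> 0 < eps -> exists i, `|z - f i| < eps) ->
  (forall i, cvgn (fun n => `|y n - f i|)) -> Fejer_path y.
Proof.
move=> fP cf z Fz; apply/cauchy_cvgP/cauchy_exP => e e0.
have e3 : 0 < e / 3 by rewrite divr_gt0.
have [i zi] := fP z _ Fz e3.
have [l yl] := (cvg_ex _).1 (cf i).
exists l; apply: filterS (cvgr_dist_lt _ _ yl _ e3) => n ln.
rewrite -ball_normE /ball_/=.
have -> : l - `|y n - z| = (l - `|y n - f i|) + (`|y n - f i| - `|y n - z|).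
  by rewrite subrKA.
rewrite (le_lt_trans (ler_normD _ _))//.
have : `| `|y n - f i| - `|y n - z| | <= `|z - f i|.
  by rewrite (le_trans (ler_dist_dist _ _))// opprB addrC addrA subrK.
by move: ln zi; lra.
Qed.

Lemma Fejer_path_bounded (y : nat -> H) : F !=set0 -> Fejer_path y ->
  exists M : R, forall n, `|y n| <= M.
Proof.
move=> [z Fz] /(_ z Fz) /cvg_seq_bounded[M [_ MP]].
exists (M + 1 + `|z|) => n; rewrite -[y n](subrK z).
rewrite (le_trans (ler_normD _ _))// lerD2r -[leLHS]normr_id.
by apply: MP => //; rewrite ltrDl.
Qed.

Lemma Fejer_path_strong_cvg (y : nat -> H) (l : H) : Fejer_path y ->
  strong_cluster y l -> F l -> y n @[n --> \oo] --> l.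
Proof.
move=> Fy [k kincr yk] Fl; apply/subr_cvg0/norm_cvg0P.
have [c yc] := (cvg_ex _).1 (Fy l Fl).
suff <- : c = 0 by [].
have h1 : `|y (k n) - l| @[n --> \oo] --> c.
  exact: (cvg_comp _ _ (increasing_seq_cvg_infty kincr) yc).
have h2 : `|y (k n) - l| @[n --> \oo] --> (0 : R).
  by apply/norm_cvg0P/subr_cvg0.
by apply: (cvg_unique (@norm_hausdorff _ R) h1 h2).
Qed.

Context (ip : {dot H for (@idfun R)}) (ipN : induces_norm ip).

Lemma strong_weak_cvg (y : nat -> H) (l : H) :
  y n @[n --> \oo] --> l -> weak_cvg ip y l.
Proof.
by move=> yl u; exact: (cvg_comp _ _ yl (@ip_continuousl _ _ _ ipN u l)).
Qed.

Lemma strong_weak_cluster (y : nat -> H) :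
  strong_cluster y `<=` weak_cluster ip y.
Proof. by move=> l [k kincr yk]; exists k => //; exact: strong_weak_cvg. Qed.

(** Opial's argument: by polarization [<y n, l1 - l2>] has a limit, which is
    both [<l1, l1 - l2>] and [<l2, l1 - l2>]. *)
Lemma Fejer_path_weak_cluster_unique (y : nat -> H) (l1 l2 : H) :
  Fejer_path y -> F l1 -> F l2 ->
  weak_cluster ip y l1 -> weak_cluster ip y l2 -> l1 = l2.
Proof.
move=> Fy Fl1 Fl2 [k1 k1incr yk1] [k2 k2incr yk2].
have [c1 yc1] := (cvg_ex _).1 (Fy l1 Fl1).
have [c2 yc2] := (cvg_ex _).1 (Fy l2 Fl2).
have polar n : ip (y n) (l1 - l2) =
    2^-1 * (`|y n - l2| * `|y n - l2| - `|y n - l1| * `|y n - l1| +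
    (`|l1| ^+ 2 - `|l2| ^+ 2)).
  by rewrite -!expr2 !(sqr_normB ipN) linearBr /=; field.
pose c := 2^-1 * (c2 * c2 - c1 * c1 + (`|l1| ^+ 2 - `|l2| ^+ 2)).
have yc : ip (y n) (l1 - l2) @[n --> \oo] --> c.
  under eq_fun do rewrite polar.
  apply: cvgM; first exact: cvg_cst.
  apply: cvgD; last exact: cvg_cst.
  by apply: cvgB; exact: cvgM.
have lim_ip l k : increasing_seq k -> weak_cvg ip (y \o k) l ->
    ip l (l1 - l2) = c.
  move=> kincr /(_ (l1 - l2)) yk.
  apply: (cvg_unique (@norm_hausdorff _ R) yk).
  exact: (cvg_comp _ _ (increasing_seq_cvg_infty kincr) yc).
apply/eqP; rewrite -subr_eq0 -normr_eq0 -sqrf_eq0 -ipN.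
by rewrite linearBl /= (lim_ip _ _ k1incr yk1) (lim_ip _ _ k2incr yk2) subrr.
Qed.

(** A bounded sequence with a single weak cluster point converges weakly. *)
Lemma Fejer_path_weak_cvg (y : nat -> H) : separable H -> F !=set0 ->
  Fejer_path y -> weak_cluster ip y `<=` F ->
  exists2 l, F l & weak_cvg ip y l.
Proof.
move=> sepH F0 Fy yF.
have [M yM] := Fejer_path_bounded F0 Fy.
have [U [UU ooU]] := ultraFilterLemma (_ : ProperFilter (\oo : set_system nat)).
have [l yl _] := ultra_weak_cluster ipN sepH UU ooU yM.
exists l; first exact: yF.
move=> u; apply/cvgrPdist_lt => e e0; apply: contrapT => far.
(* an ultrafilter of indices staying away from [l] has another weak limit *)
pose B := [set n | ~ `|ip l u - ip (y n) u| < e].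
have properB : ProperFilter (within B \oo).
  apply: Build_ProperFilter_ex => A [N _ NA].
  have [n Nn Bn] : exists2 n, (N <= n)%N & B n.
    apply: contrapT => no; apply: far; exists N => // n Nn.
    by apply: contrapT => Bn; apply: no; exists n.
  by exists n; exact: NA.
have [V [UV BV]] := ultraFilterLemma properB.
have ooV : \oo `<=` V.
  by move=> A oA; apply: BV; apply: filterS oA => n An _.
have VB : V B by apply: BV; exists 0%N.
have [l' yl' Vl'] := ultra_weak_cluster ipN sepH UV ooV yM.
have ll' : l = l'.
  by apply: (Fejer_path_weak_cluster_unique Fy) => //; exact: yF.
rewrite -ll' in Vl'.
have [n [Bn]] := filter_ex (filterI VB (cvgr_dist_lt _ _ (Vl' u) _ e0)).
exact: Bn.
Qed.

(** An almost sure pointwise limit is turned into a random vector: it is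
    redefined on a measurable null set, and is measurable because its
    inner products with fixed vectors are limits of measurable functions. *)
Lemma measurable_limit d (Omega : measurableType d) (P : probability Omega R)
    (x : nat -> Omega -> H) (Q : Omega -> H -> Prop) :
  separable H -> F !=set0 -> (forall n, random_vector (x n)) ->
  (forall w l, Q w l -> weak_cvg ip (fun n => x n w) l) ->
  {ae P, forall w, exists2 l, F l & Q w l} ->
  exists X : Omega -> H, [/\ random_vector X, (forall w, F (X w)) &
    {ae P, forall w, Q w (X w)}].
Proof.
move=> sepH [z0 Fz0] x_rv Qweak [N [mN N0 NQ]].
have Xex w : exists l, F l /\ (~ N w -> Q w l) /\ (N w -> l = z0).
  have [Nw|nNw] := pselect (N w); first by exists z0.
  have [l Fl Ql] : exists2 l, F l & Q w l.
    by apply: contrapT => nQ; apply/nNw/NQ.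
  by exists l.
have [X XP] := choice Xex.
exists X; split.
- apply: (weakly_measurable_random_vector ipN sepH) => u.
  have mx n : measurable_fun setT (fun w => ip (x n w) u).
    apply: (measurableT_comp (f := (fun v => ip v u) : borel H -> R)).
      by apply: continuous_borel_measurable; exact: ip_continuousl.
    exact: x_rv.
  apply: (@measurable_fun_cvg _ _ _ setT
    (fun n w => if w \in N then ip z0 u else ip (x n w) u)) => //.
    move=> n; apply: measurable_fun_ifT => //.
    apply: (measurable_fun_bool true); rewrite setTI (_ : _ @^-1` _ = N)//.
    by apply/seteqP; split=> w /=; [exact: set_mem|exact: mem_set].
  move=> w _; have [_ [XQ Xz]] := XP w.
  have [Nw|nNw] := pselect (N w).
    rewrite Xz// mem_set//; exact: cvg_cst.
  rewrite memNset//; exact: (Qweak _ _ (XQ nNw)).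
- by move=> w; have [] := XP w.
- exists N; split=> // w /=; apply: contra_notP => nNw.
  by have [_ [XQ _]] := XP w; exact: XQ.
Qed.

End Fejer_paths.

(** * Convergence of stochastic Fejer sequences *)

Theorem proposition2p3 (R : realType) (H : completeNormedModType R)
    (ip : {dot H for (@idfun R)}) (ip_norm : induces_norm ip)
    (sepH : separable H)
    (d : measure_display) (Omega : measurableType d) (P : probability Omega R)
    (F : set H) (F0 : F !=set0) (Fclosed : closed F)
    (phi : R -> R) (phi_ge0 : forall t, 0 <= t -> 0 <= phi t)
    (phi_incr : forall s t, 0 <= s -> s < t -> phi s < phi t)
    (phi_infty : phi t @[t --> +oo] --> +oo)
    (x : nat -> Omega -> H) (x_rv : forall n, random_vector (x n))
    (chi theta eta : H -> nat -> Omega -> R)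
    (chi_ell1 : forall z, F z -> ell1_plus P (natural_filtration x) (chi z))
    (theta_ell : forall z, F z -> ell_plus (natural_filtration x) (theta z))
    (eta_ell1 : forall z, F z -> ell1_plus P (natural_filtration x) (eta z))
    (fejer : forall z, F z ->
      exists2 Y : nat -> Omega -> \bar R,
        (forall n, is_cond_exp P (natural_filtration x n)
                     (fun w => (phi `|x n.+1 w - z|)%:E) (Y n)) &
        {ae P, forall w, forall n,
          (Y n w + (theta z n w)%:E <=
           ((1 + chi z n w) * phi `|x n w - z| + eta z n w)%:E)%E}) :
  (forall z, F z ->
    {ae P, forall w, (\sum_(0 <= n <oo) (theta z n w)%:E < +oo)%E}) /\
  {ae P, forall w, bounded_fun (fun n => x n w)} /\
  (exists Omega' : set Omega,
    [/\ measurable Omega', P Omega' = 1%E &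
        forall w, Omega' w -> forall z, F z -> cvgn (fun n => `|x n w - z|)]) /\
  ({ae P, forall w, weak_cluster ip (fun n => x n w) `<=` F} ->
    exists X : Omega -> H,
      [/\ random_vector X, (forall w, F (X w)) &
          {ae P, forall w, weak_cvg ip (fun n => x n w) (X w)}]) /\
  ({ae P, forall w, strong_cluster (fun n => x n w) `&` F !=set0} ->
    exists X : Omega -> H,
      [/\ random_vector X, (forall w, F (X w)) &
          {ae P, forall w, x n w @[n --> \oo] --> X w}]) /\
  ({ae P, forall w, strong_cluster (fun n => x n w) !=set0} ->
   {ae P, forall w, weak_cluster ip (fun n => x n w) `<=` F} ->
    exists X : Omega -> H,
      [/\ random_vector X, (forall w, F (X w)) &
          {ae P, forall w, x n w @[n --> \oo] --> X w}]).
Proof.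
have Fl_sub n := @natural_filtration_sub _ _ _ _ x n x_rv.
have dist_continuous (z : H) : continuous (fun v : H => `|v - z|).
  by move=> v; apply: cvg_norm; apply: cvgB; [exact: cvg_id|exact: cvg_cst].
have V_ell z : ell_plus (natural_filtration x) (fun n w => phi `|x n w - z|).
  move=> n; split=> [w|]; first exact: phi_ge0.
  (* [phi] is monotone on the nonnegative half-line only *)
  pose psi t := phi (Num.max 0 t).
  have mpsi : measurable_fun setT psi.
    apply: nondecreasing_measurable => // s t st.
    have : Num.max 0 s <= Num.max 0 t by rewrite ge_max !le_max lexx st orbT.
    rewrite /psi le_eqVlt => /predU1P[->//|st'].
    by apply/ltW/phi_incr => //; rewrite le_max lexx.
  rewrite (_ : (fun w => _) = psi \o ((fun v => `|v - z|) \o x n)).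
    by apply: measurableT_comp => //; exact: natural_filtration_adapted.
  by apply/funext => w; rewrite /psi /= max_r.
have RS z : F z -> {ae P, forall w, cvgn (fun n => `|x n w - z|) /\
    (\sum_(0 <= n <oo) (theta z n w)%:E < +oo)%E}.
  move=> Fz; have [Y Ycond Yle] := fejer z Fz.
  have := almost_supermartingale_cvg Fl_sub
    (@natural_filtration_sigma _ _ _ _ x) (@natural_filtration_mono _ _ _ _ x)
    (V_ell z) (chi_ell1 z Fz) (theta_ell z Fz) (eta_ell1 z Fz) Ycond Yle.
  apply: filterS => w [cV ct]; split=> //.
  exact: (cvgn_of_increasing phi_incr phi_infty _ cV).
have [f Ff fdense] := separable_subset sepH F0.
have paths : {ae P, forall w, Fejer_path F (fun n => x n w)}.
  have : {ae P, forall w, forall i, cvgn (fun n => `|x n w - f i|)}.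
    apply: ae_foralln => i; apply: filterS (RS _ (Ff i)) => w; by case.
  by apply: filterS => w; exact: Fejer_path_dense.
have strong : {ae P, forall w, strong_cluster (fun n => x n w) `&` F !=set0} ->
    exists X : Omega -> H, [/\ random_vector X, (forall w, F (X w)) &
      {ae P, forall w, x n w @[n --> \oo] --> X w}].
  move=> cluster.
  apply: (measurable_limit ip_norm (Q := fun w l => x n w @[n --> \oo] --> l)
    sepH F0 x_rv) => [w l|]; first exact: strong_weak_cvg.
  apply: filterS2 paths cluster => w pw [l [sl Fl]].
  by exists l => //; exact: (Fejer_path_strong_cvg pw).
split; [|split; [|split; [|split; [|split]]]].
- by move=> z Fz; apply: filterS (RS z Fz) => w [].
- apply: filterS paths => w pw; have [M xM] := Fejer_path_bounded F0 pw.
  exists M; split; first exact: num_real.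
  by move=> M' MM' n _ /=; exact: le_trans (xM n) (ltW MM').
- have [N [mN N0 Npaths]] := paths.
  exists (~` N); split; first exact: measurableC.
    by rewrite probability_setC// N0 sube0.
  by move=> w Nw; apply: contrapT => npw; exact/Nw/Npaths.
- move=> wF.
  apply: (measurable_limit ip_norm
    (Q := fun w l => weak_cvg ip (fun n => x n w) l) sepH F0 x_rv) => //.
  apply: filterS2 paths wF => w pw; exact: Fejer_path_weak_cvg.
- exact: strong.
- move=> s0 wF; apply: strong; apply: filterS2 s0 wF => w [l sl] lF.
  by exists l; split=> //; exact/lF/(strong_weak_cluster ip_norm).
Qed.
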